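(* Let $\Delta$ be a $(d-1)$-dimensional simplicial complex. Then for $0\le k\le d-1$, $$f_k(\mathrm{Int}(\Delta))=\sum_{l=0}^{d}\sum_{i=0}^{k}(-1)^i\binom{k}{i}\big[(2+2k-2i)^{l}-(1+2k-2i)^{l}\big]f_{l-1}(\Delta),$$ and $f_{-1}(\mathrm{Int}(\Delta))=f_{-1}(\Delta)=1$.
   Context: Simplicial complexes are finite abstract simplicial complexes on a ground set $[n]=\{1,\ldots,n\}$, containing the empty face $\emptyset$ (of dimension $-1$); $f_i(\Delta)$ is the number of $i$-dimensional faces of $\Delta$, with $f_{-1}(\Delta)=1$. Interval subdivision: let $I(\Delta\setminus\{\emptyset\})=\{[A,B] : \emptyset\ne A\subseteq B\in\Delta\}$, partially ordered by $[A,B]\subseteq[A',B']$ iff $A'\subseteq A\subseteq B\subseteq B'$. Then $\mathrm{Int}(\Delta)$ is the simplicial complex on the ground set $I(\Delta\setminus\{\emptyset\})$ whose faces are all chains of this poset; an $l$-dimensional face is a strict chain $[A_0,B_0]\subset\cdots\subset[A_l,B_l]$. *)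

(* Defs.v *)
From HB Require Import structures.
From mathcomp Require Import all_boot all_order all_algebra.

Set Implicit Arguments.
Unset Strict Implicit.
Unset Printing Implicit Defensive.

Import Order.TTheory GRing.Theory Num.Theory.

Local Open Scope ring_scope.

(* The vertices may form a proper subset of the ground set T. *)
Record complex (T : finType) := Complex {
  faces :> {set {set T}};
  complex_set0 : set0 \in faces;
  complex_sub : forall s t : {set T}, t \in faces -> s \subset t -> s \in faces
}.

Definition face_dim (T : finType) (s : {set T}) : int := #|s|%:Z - 1.

(* The default value -1 is the dimension of the empty face. *)
Definition complex_dim (T : finType) (D : complex T) : int :=
  \big[Order.max/(-1)]_(s in D) face_dim s.

Definition fnum (T : finType) (D : complex T) (i : int) : nat :=
  #|[set s in D | face_dim s == i]|.

Section OrderComplex.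
Context {disp : Order.disp_t} (P : finPOrderType disp).

Definition is_chain (c : {set P}) : bool :=
  [forall x in c, forall y in c, (x >=< y)%O].

Definition chains : {set {set P}} := [set c | is_chain c].

Lemma chains_set0 : set0 \in chains.
Proof. by rewrite inE; apply/forall_inP => x; rewrite inE. Qed.

Lemma chains_sub (s t : {set P}) : t \in chains -> s \subset t -> s \in chains.
Proof.
rewrite !inE => /forall_inP ct /subsetP st.
apply/forall_inP => x /st xt; apply/forall_inP => y /st yt.
by have /forall_inP := ct x xt; apply.
Qed.

Definition order_complex : complex P := Complex chains_set0 chains_sub.

End OrderComplex.

Section Intervals.
Context {T : finType} (D : complex T).

(* The pair (A, B) stands for the interval [A, B]. *)
Record interval_of := Interval {
  bounds : {set T} * {set T};
  boundsP : [&& bounds.1 != set0, bounds.1 \subset bounds.2 & bounds.2 \in faces D]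
}.

HB.instance Definition _ := [isSub for bounds].
HB.instance Definition _ := [Finite of interval_of by <:].

Definition interval_le (u v : interval_of) : bool :=
  ((bounds v).1 \subset (bounds u).1) && ((bounds u).2 \subset (bounds v).2).

Lemma interval_le_refl : reflexive interval_le.
Proof. by move=> u; rewrite /interval_le !subxx. Qed.

Lemma interval_le_anti : antisymmetric interval_le.
Proof.
move=> u v /andP[/andP[A1 B1] /andP[A2 B2]]; apply: val_inj => /=.
rewrite [bounds u]surjective_pairing [bounds v]surjective_pairing.
by congr (_, _); apply/eqP; rewrite eqEsubset ?A1 ?A2 ?B1 ?B2.
Qed.

Lemma interval_le_trans : transitive interval_le.
Proof.
move=> v u w /andP[A1 B1] /andP[A2 B2]; apply/andP; split.
  exact: subset_trans A2 A1.
exact: subset_trans B1 B2.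
Qed.

Fact interval_display : Order.disp_t. Proof. exact: Order.Disp tt tt. Qed.

HB.instance Definition _ := Order.Le_isPOrder.Build interval_display interval_of
  interval_le_refl interval_le_anti interval_le_trans.

Definition interval_subdivision : complex interval_of := order_complex interval_of.

End Intervals.

(* Main.v *)
Require Import Defs.
From mathcomp Require Import all_boot all_order all_algebra.

Import Order.TTheory GRing.Theory Num.Theory.
Local Open Scope ring_scope.

(** Strict chains in a finite poset are counted by passing through weak ones.
Let [s k x] be the number of strict chains of k + 1 elements with greatest
element x, and [z r x] the number of weak chains x_0 <= ... <= x_r = x. Removing
the greatest element shows that [s] is obtained from the constant function 1 by
iterating the strict summation operator N, with N f x the sum of f over y < x
([card_topped_chainsS]), while [z] is obtained by iterating Z = 1 + N, the
summation over y <= x. Hence N ^ k = (Z - 1) ^ k, and the binomial theorem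
writes [s k] as an alternating combination of the z (k - i)
([strict_iteration]).

For intervals, weak chains are easy to count. In a weak chain of r + 1 intervals
with greatest element [A, B], a vertex of B outside A is classified by the
moment at which it leaves the lower ends or enters the upper ends, which leaves
2 r + 1 possibilities, chosen independently; so z r [A, B] = (2 r + 1) ^ |B - A|.
This is confirmed by the recursion for Z in [sum_below_interval]; all
intervals met on the way are legitimate, since a set containing A is nonempty
and a subset of B is a face. Summing over the nonempty A contained in a face B
gives (2 r + 2) ^ |B| - (2 r + 1) ^ |B| ([sum_all_intervals]), the subtracted
term being the contribution of the empty A. Taking r = k - i and grouping the
faces B by cardinality gives the formula. *)

(** * Sums over the sets between two sets *)

(** Expanding the product over the elements of B outside A of p + q: choosing p
puts the element in S, choosing q leaves it out. *)
Lemma sum_between_expr (R : comNzRingType) (T : finType) (A B : {set T})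
    (p q : R) : A \subset B ->
  \sum_(S : {set T} | (A \subset S) && (S \subset B))
     p ^+ #|S :\: A| * q ^+ #|B :\: S| = (p + q) ^+ #|B :\: A|.
Proof.
move=> sAB.
(* The zero factors kill the terms of the expansion indexed by sets that are
   not between A and B. *)
pose F x := if x \in A then 1 else if x \in B then p else 0 : R.
pose G x := if x \in A then 0 else if x \in B then q else 1 : R.
have prod_in (E : {set T}) (c : R) : c ^+ #|E| = \prod_x (if x \in E then c else 1).
  by rewrite -big_mkcond prodr_const.
transitivity (\prod_x (F x + G x)); last first.
  rewrite prod_in; apply: eq_bigr => x _; rewrite /F /G in_setD.
  by case: ifP => _ /=; [rewrite addr0 | case: ifP => _ //; rewrite add0r].
rewrite bigA_distr [LHS]big_mkcond; apply: eq_bigr => S _.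
case: ifPn => [/andP[/subsetP sAS /subsetP sSB] | nS].
  rewrite !prod_in -big_split; apply: eq_bigr => x _ /=.
  rewrite /F /G !in_setD; have := sAS x; have := sSB x.
  case: (x \in A) => /=; case: (x \in S) => /=; case: (x \in B) => /= h1 h2;
    rewrite ?mulr1 ?mul1r //; first [by have := h1 isT | by have := h2 isT].
move: nS; rewrite negb_and => /orP[] /subsetPn[x xA xS];
  rewrite (bigD1 x) //= /F /G.
  by rewrite (negPf xS) xA mul0r.
rewrite xA (negPf xS).
by rewrite ifN ?mul0r //; apply: contra xS => /(subsetP sAB).
Qed.

(** * Chains of a finite poset by their greatest element *)

Definition topped_chains {disp} {P : finPOrderType disp} (k : nat) (x : P) :
    {set {set P}} :=
  [set c in chains P | [&& #|c| == k.+1, x \in c & [forall y in c, (y <= x)%O]]].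

Lemma topped_chainsP {disp} {P : finPOrderType disp} k (x : P) (c : {set P}) :
  reflect [/\ is_chain c, #|c| = k.+1, x \in c & {in c, forall y, (y <= x)%O}]
          (c \in topped_chains k x).
Proof.
rewrite !inE; apply: (iffP and4P) => [[? /eqP ? ? /forall_inP] | [? -> ? h]] //.
by split=> //; apply/forall_inP.
Qed.

(** An element of the chain with the most elements of the poset below it works:
a larger one in the chain would have strictly more. *)
Lemma chain_max {disp} {P : finPOrderType disp} (c : {set P}) :
  is_chain c -> c != set0 -> exists2 x, x \in c & {in c, forall y, (y <= x)%O}.
Proof.
move=> /forall_inP chc /set0Pn[x0 x0c].
pose down x := [set y : P | (y <= x)%O].
case: (arg_maxnP (fun x => #|down x|) x0c) => x xc maxx; exists x => // y yc.
have /forall_inP/(_ y yc) := chc x xc.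
rewrite comparable_sym => /orP[] // lexy; have [<- // | nxy] := eqVneq x y.
have /proper_card : down x \proper down y.
  apply/properP; split; first by apply/subsetP => z; rewrite !inE => /le_trans; apply.
  by exists y; rewrite inE ?lexx // lt_geF // lt_neqAle nxy.
by rewrite ltnNge [(_ <= _)%N](maxx y yc).
Qed.

Lemma topped_chains_inj {disp} {P : finPOrderType disp} k l (x y : P) c :
  c \in topped_chains k x -> c \in topped_chains l y -> x = y.
Proof.
move=> /topped_chainsP[_ _ xc lex] /topped_chainsP[_ _ yc ley].
by apply/le_anti; rewrite lex ?ley.
Qed.

Lemma card_topped_chains0 {disp} {P : finPOrderType disp} (x : P) :
  #|topped_chains 0 x| = 1%N.
Proof.
apply/eqP/cards1P; exists [set x]; apply/setP => c; rewrite in_set1.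
apply/topped_chainsP/eqP => [[_ /eqP/cards1P[y ->]] | ->].
  by move=> /set1P->.
split; rewrite ?cards1 ?set11 //; last by move=> y /set1P->.
by apply/forall_inP => y /set1P->; apply/forall_inP => z /set1P->; apply: comparablexx.
Qed.

(** Deleting the greatest element x of a chain leaves a nonempty chain whose own
greatest element y is below x, and x can be put back. *)
Lemma card_topped_chainsS {disp} {P : finPOrderType disp} k (x : P) :
  #|topped_chains k.+1 x| = (\sum_(y | (y < x)%O) #|topped_chains k y|)%N.
Proof.
have topS y c : (y < x)%O -> c \in topped_chains k y ->
    x \notin c /\ x |: c \in topped_chains k.+1 x.
  move=> ltyx /topped_chainsP[/forall_inP chc cc yc ley].
  have ltcx z : z \in c -> (z < x)%O by move=> /ley /le_lt_trans; apply.
  have nxc : x \notin c by apply/negP => /ltcx; rewrite ltxx.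
  split=> //; apply/topped_chainsP; split; rewrite ?cardsU1 ?nxc ?cc ?setU11 //.
    apply/forall_inP => u /setU1P[-> | uc]; apply/forall_inP => v /setU1P[-> | vc].
    + exact: comparablexx.
    + by rewrite ge_comparable // ltW ?ltcx.
    + by rewrite le_comparable // ltW ?ltcx.
    + by have /forall_inP := chc u uc; apply.
  by move=> z /setU1P[-> // | /ltcx/ltW].
rewrite -(card_in_imset (f := fun c => c :\ x)); last first.
  move=> c c' /topped_chainsP[_ _ xc _] /topped_chainsP[_ _ xc' _] eqc.
  by rewrite -(setD1K xc) eqc setD1K.
rewrite -sum1_card.
rewrite (eq_bigl (fun c => [exists y, (y < x)%O && (c \in topped_chains k y)])); last first.
  move=> c; apply/imsetP/existsP => [[e + ->] | [y /andP[ltyx cy]]].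
    move=> /topped_chainsP[/forall_inP che ce xe lex].
    have cD : #|e :\ x| = k.+1 by move: ce; rewrite (cardsD1 x) xe => -[].
    have chD : is_chain (e :\ x).
      apply/forall_inP => u /setD1P[_ ue]; apply/forall_inP => v /setD1P[_ ve].
      by have /forall_inP := che u ue; apply.
    have [|y yD ley] := chain_max _ chD; first by rewrite -card_gt0 cD.
    exists y; apply/andP; split; last exact/topped_chainsP.
    by move: yD => /setD1P[nyx ye]; rewrite lt_neqAle nyx lex.
  have [nxc xcT] := topS y c ltyx cy; exists (x |: c) => //.
  by rewrite setU1K.
under [RHS]eq_bigr => y _ do rewrite -sum1_card.
rewrite (exchange_big_dep (fun c => [exists y, (y < x)%O && (c \in topped_chains k y)])) /=.
  apply: eq_bigr => c /existsP[y /andP[ltyx cy]].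
  rewrite (big_pred1 y) // => z; apply/andP/eqP => [[_ cz] | ->] //.
  exact: topped_chains_inj cz cy.
by move=> y c ltyx cy; apply/existsP; exists y; rewrite ltyx.
Qed.

Lemma fnum_order_complex {disp} (P : finPOrderType disp) (k : nat) :
  fnum (order_complex P) k%:Z = (\sum_(x : P) #|topped_chains k x|)%N.
Proof.
have dimE (c : {set P}) : (face_dim c == k%:Z) = (#|c| == k.+1).
  by rewrite /face_dim subr_eq -[k%:Z + 1]/((k + 1)%:Z) addn1 eqz_nat.
rewrite /fnum -sum1_card.
rewrite (eq_bigl (fun c => [exists x, c \in topped_chains k x])); last first.
  move=> c; rewrite !inE dimE; apply/andP/existsP => [[chc /eqP cc] | [x]].
    have [|x xc lex] := chain_max _ chc; first by rewrite -card_gt0 cc.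
    by exists x; apply/topped_chainsP.
  by move=> /topped_chainsP[chc /eqP cc _ _].
under [RHS]eq_bigr => x _ do rewrite -sum1_card.
rewrite (exchange_big_dep (fun c => [exists x, c \in topped_chains k x])) /=.
  apply: eq_bigr => c /existsP[x cx].
  rewrite (big_pred1 x) // => y; apply/idP/eqP => [cy | ->] //.
  exact: topped_chains_inj cy cx.
by move=> x c _ cx; apply/existsP; exists x.
Qed.

(** The binomial expansion of (Z - 1) ^ k applied to [z 0], where Z f x is the sum
of f over y <= x. In the induction the strict sum of [z j] is the difference
z (j + 1) - z j, so that Pascal's rule produces the next row. *)
Lemma strict_iteration {disp} {P : finPOrderType disp} (R : pzRingType)
    (z s : nat -> P -> R) :
  (forall x, s 0 x = z 0 x) ->
  (forall k x, s k.+1 x = \sum_(y | (y < x)%O) s k y) ->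
  (forall k x, z k.+1 x = \sum_(y | (y <= x)%O) z k y) ->
  forall k x, s k x = \sum_(i < k.+1) (-1) ^+ i * 'C(k, i)%:R * z (k - i)%N x.
Proof.
move=> s0 sS zS; elim=> [|k IHk] x.
  by rewrite big_ord1 s0 !mul1r.
have zlt j : \sum_(y | (y < x)%O) z j y = z j.+1 x - z j x.
  rewrite zS [in RHS](bigD1 x) //= [RHS]addrC addKr.
  by apply: eq_bigl => y; rewrite lt_neqAle andbC.
rewrite sS (eq_bigr _ (fun y _ => IHk y)) exchange_big /=.
under eq_bigr => i _ do rewrite -mulr_sumr zlt mulrBr -subSn ?leq_ord //.
rewrite sumrB [RHS]big_ord_recl /= /bump /=.
under [X in _ = _ + X]eq_bigr => i _ do
  rewrite add1n binS natrD mulrDr mulrDl subSS.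
rewrite big_split /= addrA; congr (_ + _); last first.
  by rewrite -sumrN; apply: eq_bigr => i _; rewrite exprS mulN1r !mulNr.
rewrite [in LHS]big_ord_recl [in RHS]big_ord_recr /= !bin0 (bin_small (ltnSn k)).
rewrite mulr0 mul0r addr0; congr (_ + _).
Qed.

(** * Weak chains of intervals *)

Lemma sum_intervals (R : nmodType) (T : finType) (D : complex T)
    (Q : pred ({set T} * {set T})) (F : {set T} * {set T} -> R) :
  \sum_(u : interval_of D | Q (bounds u)) F (bounds u) =
  \sum_(p : {set T} * {set T} | [&& p.1 != set0, p.1 \subset p.2 & p.2 \in faces D] && Q p) F p.
Proof.
rewrite -(big_map (@bounds T D) Q F) -big_filter_cond; apply: perm_big.
apply: uniq_perm.
- by rewrite map_inj_uniq ?index_enum_uniq //; apply: val_inj.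
- by rewrite filter_uniq ?index_enum_uniq.
move=> p; rewrite mem_filter mem_index_enum andbT.
apply/mapP/idP => [[u _ ->] | pP]; first exact: boundsP.
by exists (Defs.Interval pP); rewrite ?mem_index_enum.
Qed.

(** Each vertex of B outside A lies in the lower end of v, outside its upper
end, or in between with weight q, whence the factor q + 2. With q = 2 r + 1 it
says that (2 r + 1) ^ |B - A| satisfies the recursion of the number of weak
chains of r + 1 intervals below [A, B]. *)
Lemma sum_below_interval (R : comNzRingType) (T : finType) (D : complex T)
    (u : interval_of D) (q : R) :
  \sum_(v | (v <= u)%O) q ^+ #|(bounds v).2 :\: (bounds v).1|
  = (q + 2) ^+ #|(bounds u).2 :\: (bounds u).1|.
Proof.
case: u => -[A B] uP; have /and3P[/= An0 sAB DB] := uP.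
rewrite (sum_intervals _ _ _ (fun p => (A \subset p.1) && (p.2 \subset B))
           (fun p => q ^+ #|p.2 :\: p.1|)).
transitivity (\sum_(A' : {set T} | (A \subset A') && (A' \subset B))
    \sum_(B' : {set T} | (A' \subset B') && (B' \subset B)) q ^+ #|B' :\: A'|).
  rewrite pair_big_dep; apply: eq_bigl => -[A' B'] /=.
  apply/andP/andP => [[/and3P[_ s1 _] /andP[s2 s3]] | [/andP[s1 s2] /andP[s3 s4]]].
    by rewrite s2 s1 s3 (subset_trans s1).
  rewrite s3 s1 s4 (complex_sub DB s4); split=> //; rewrite !andbT.
  by apply: contraNN An0 => /eqP A'0; rewrite -subset0 -A'0.
transitivity (\sum_(A' : {set T} | (A \subset A') && (A' \subset B))
    1 ^+ #|A' :\: A| * (q + 1) ^+ #|B :\: A'|).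
  apply: eq_bigr => A' /andP[_ sA'B]; rewrite expr1n mul1r -sum_between_expr //.
  by apply: eq_bigr => B' _; rewrite expr1n mulr1.
by rewrite sum_between_expr // addrC -addrA.
Qed.

(** For a fixed face B, the sum over all subsets A of B is (q + 1) ^ |B|, and
the empty set, which is not the lower end of an interval, accounts for
q ^ |B|. *)
Lemma sum_all_intervals (R : comNzRingType) (T : finType) (D : complex T) (q : R) :
  \sum_(u : interval_of D) q ^+ #|(bounds u).2 :\: (bounds u).1|
  = \sum_(B in D) ((q + 1) ^+ #|B| - q ^+ #|B|).
Proof.
rewrite (sum_intervals _ _ _ xpredT (fun p => q ^+ #|p.2 :\: p.1|)).
transitivity (\sum_(A : {set T} | A != set0)
    \sum_(B : {set T} | (A \subset B) && (B \in D)) q ^+ #|B :\: A|).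
  by rewrite pair_big_dep; apply: eq_bigl => -[A B]; rewrite andbT.
rewrite (exchange_big_dep [in D]) /=; last by move=> A B _ /andP[].
apply: eq_bigr => B DB; rewrite -[X in X ^+ #|B|]addrC.
have := sum_between_expr R T set0 B 1 q (sub0set B).
rewrite setD0 => <-; rewrite [in RHS](bigD1 set0) ?sub0set //= addrAC !setD0.
rewrite expr1n mul1r subrr add0r.
apply: eq_big => [A | A _]; last by rewrite expr1n mul1r.
by rewrite sub0set DB andbT andbC.
Qed.

(** * Face numbers *)

Lemma sum_faces_by_card (R : pzRingType) (T : finType) (D : complex T) (d : nat)
    (g : nat -> R) : complex_dim D = d%:Z - 1 ->
  \sum_(B in D) g #|B| = \sum_(l < d.+1) g l * (fnum D (l%:Z - 1))%:R.
Proof.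
move=> dimD.
have cardD B : B \in D -> (#|B| <= d)%N.
  move=> DB; rewrite -lez_nat -(lerD2r (-1)) -dimD.
  exact: (le_bigmax_cond _ (@face_dim T) DB).
rewrite (partition_big (fun B : {set T} => inord #|B| : 'I_d.+1) xpredT) //=.
apply: eq_bigr => l _.
rewrite (eq_big (fun B => B \in [set s in D | face_dim s == l%:Z - 1]) (fun=> g l)).
- by rewrite sumr_const mulr_natr.
- move=> B; rewrite inE /face_dim (inj_eq (addIr _)) eqz_nat.
  by apply: andb_id2l => DB; rewrite -val_eqE /= inordK // ltnS cardD.
by move=> B /andP[DB /eqP<-]; rewrite inordK // ltnS cardD.
Qed.

Lemma fnumN1 (T : finType) (D : complex T) : fnum D (-1) = 1%N.
Proof.
apply/eqP/cards1P; exists set0; apply/setP => s; rewrite !inE /face_dim.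
rewrite -[X in _ == X]add0r (inj_eq (addIr _)) eqz_nat cards_eq0.
by case: eqP => [-> | _]; rewrite ?complex_set0 ?andbF.
Qed.

Theorem theorem2p2 (n d : nat) (D : complex 'I_n)
    (dimD : complex_dim D = d%:Z - 1) :
  (forall k : nat, (k < d)%N ->
     (fnum (interval_subdivision D) k%:Z)%:Z =
       \sum_(0 <= l < d.+1) \sum_(0 <= i < k.+1)
          (-1) ^+ i * ('C(k, i))%:Z *
          ((2 + 2 * k%:Z - 2 * i%:Z) ^+ l - (1 + 2 * k%:Z - 2 * i%:Z) ^+ l) *
          (fnum D (l%:Z - 1))%:Z) /\
  (fnum (interval_subdivision D) (-1) = fnum D (-1) /\ fnum D (-1) = 1%N).
Proof.
split=> [k _|]; last by rewrite !fnumN1.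
pose w (u : interval_of D) := #|(bounds u).2 :\: (bounds u).1|.
have chainsE u : #|topped_chains k u|%:Z =
    \sum_(i < k.+1) (-1) ^+ i * 'C(k, i)%:R * (2 * (k - i)%N%:Z + 1) ^+ w u.
  apply: (strict_iteration int (fun r v => (2 * r%:Z + 1) ^+ w v)
            (fun r v => #|topped_chains r v|%:Z)) => [v | r v | r v].
  - by rewrite card_topped_chains0 mulr0 add0r expr1n.
  - rewrite card_topped_chainsS -natz natr_sum.
    by apply: eq_bigr => y _; rewrite natz.
  - rewrite sum_below_interval; congr (_ ^+ _).
    by rewrite intS mulrDr mulr1 -addrA addrC.
rewrite fnum_order_complex -natz natr_sum.
rewrite (eq_bigr _ (fun u _ => etrans (natz _) (chainsE u))).
rewrite exchange_big /= [RHS]exchange_big /= big_mkord.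
apply: eq_bigr => i _; rewrite -mulr_sumr sum_all_intervals.
rewrite (sum_faces_by_card _ _ _ _ (fun l => _ ^+ l - _ ^+ l) dimD).
rewrite mulr_sumr big_mkord; apply: eq_bigr => l _.
rewrite !natz mulrA -subzn ?leq_ord // [2 * _]mulrBr.
congr (_ * (_ ^+ _ - _ ^+ _) * _); first by rewrite -addrA addrC addrA.
by rewrite addrC addrA.
Qed.
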